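(* Let $\gamma \geq 0$ be an integer. The operad $\mathsf{Dias}_\gamma$ admits the following presentation. It is generated by the set $\mathfrak{G} = \{\dashv_a, \vdash_a : a \in [\gamma]\}$ of binary generators, and its space of relations is the space induced by the equivalence relation $\leftrightarrow_\gamma$ satisfying $$\dashv_a \circ_1 \vdash_{a'} \;\leftrightarrow_\gamma\; \vdash_{a'} \circ_2 \dashv_a, \qquad a, a' \in [\gamma],$$ $$\dashv_a \circ_1 \dashv_b \;\leftrightarrow_\gamma\; \dashv_a \circ_2 \vdash_b, \qquad a < b \in [\gamma],$$ $$\vdash_a \circ_1 \dashv_b \;\leftrightarrow_\gamma\; \vdash_a \circ_2 \vdash_b, \qquad a < b \in [\gamma],$$ $$\dashv_b \circ_1 \dashv_a \;\leftrightarrow_\gamma\; \dashv_a \circ_2 \dashv_b, \qquad a < b \in [\gamma],$$ $$\vdash_a \circ_1 \vdash_b \;\leftrightarrow_\gamma\; \vdash_b \circ_2 \vdash_a, \qquad a < b \in [\gamma],$$ $$\dashv_d \circ_1 \dashv_d \;\leftrightarrow_\gamma\; \dashv_d \circ_2 \dashv_c \;\leftrightarrow_\gamma\; \dashv_d \circ_2 \vdash_c, \qquad c \leq d \in [\gamma],$$ $$\vdash_d \circ_1 \dashv_c \;\leftrightarrow_\gamma\; \vdash_d \circ_1 \vdash_c \;\leftrightarrow_\gamma\; \vdash_d \circ_2 \vdash_d, \qquad c \leq d \in [\gamma].$$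
   Context: The ground field $\mathbb{K}$ has characteristic zero; operad means nonsymmetric operad in $\mathbb{K}$-vector spaces; $[\gamma] = \{1, \dots, \gamma\}$. Definition of $\mathsf{Dias}_\gamma$: let $\mathcal{M}_\gamma$ be the monoid $\{0\} \cup [\gamma]$ with product $\max$. The operad $\mathsf{T}\mathcal{M}_\gamma$ has as component of arity $n \geq 1$ the linear span of the words of length $n$ on $\mathcal{M}_\gamma$, with partial compositions $u \circ_i v := u_1 \dots u_{i-1}\, \max(u_i, v_1) \dots \max(u_i, v_m)\, u_{i+1} \dots u_n$ (for $u$ of length $n$, $v$ of length $m$, $i \in [n]$) and unit the word $0$. $\mathsf{Dias}_\gamma$ is the suboperad of $\mathsf{T}\mathcal{M}_\gamma$ generated by the words $0a$ and $a0$, $a \in [\gamma]$. Presentations: for a set $\mathfrak{G}$ of generators of arity $2$, $\mathbf{Free}(\mathfrak{G})$ is the free operad, whose component of arity $n$ is spanned by the planar binary trees with $n$ leaves whose internal nodes are labeled by $\mathfrak{G}$, $\mathfrak{s} \circ_i \mathfrak{t}$ being the grafting of the root of $\mathfrak{t}$ on the $i$th leaf of $\mathfrak{s}$; for $x, y \in \mathfrak{G}$, $x \circ_i y$ denotes the corresponding tree with two internal nodes. An operad $\mathcal{O}$ admits the presentation $(\mathfrak{G}, \mathfrak{R})$, where $\mathfrak{R}$ is a subspace of $\mathbf{Free}(\mathfrak{G})$, if $\mathcal{O} \cong \mathbf{Free}(\mathfrak{G})/\langle \mathfrak{R} \rangle$, $\langle \mathfrak{R} \rangle$ being the operad ideal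 generated by $\mathfrak{R}$. The space induced by an equivalence relation $\leftrightarrow$ on trees is the subspace spanned by all $x - x'$ with $x \leftrightarrow x'$. *)

(* Defs.v *)
From HB Require Import structures.
From mathcomp Require Import all_boot all_order all_algebra.
From mathcomp Require Import zify finmap boolp.
From mathcomp.multinomials Require Import monalg.
From Stdlib Require Import Relation_Operators.

Set Implicit Arguments.
Unset Strict Implicit.
Unset Printing Implicit Defensive.

Import Order.TTheory GRing.Theory.
Local Open Scope ring_scope.

(* Every family (T n) indexed by n : nat below is indexed so that T n is the
   component of arity n.+1; there is no component of arity 0.  Inputs are
   numbered from 0, so that the index i : 'I_n.+1 stands for the partial
   composition usually written with the subscript i.+1.                       *)

Record operad (K : fieldType) := Operad {
  op_car :> nat -> lmodType K;
  op_one : op_car 0;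
  op_comp : forall n m, op_car n -> 'I_n.+1 -> op_car m -> op_car (n + m);
  op_linl : forall n m (i : 'I_n.+1) (y : op_car m),
    linear (fun x : op_car n => op_comp x i y);
  op_linr : forall n m (x : op_car n) (i : 'I_n.+1),
    linear (fun y : op_car m => op_comp x i y);
  op_one_comp : forall m (x : op_car m), op_comp op_one ord0 x = x;
  op_comp_one : forall n (x : op_car n) (i : 'I_n.+1),
    op_comp x i op_one = ecast k (op_car k) (esym (addn0 n)) x;
  op_seq : forall n m p (x : op_car n) (y : op_car m) (z : op_car p)
      (i : 'I_n.+1) (j : 'I_m.+1),
    op_comp (op_comp x i y) (inord (i + j)) z =
    ecast k (op_car k) (addnA n m p) (op_comp x i (op_comp y j z));
  op_par : forall n m p (x : op_car n) (y : op_car m) (z : op_car p)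
      (i j : 'I_n.+1), (i < j)%N ->
    op_comp (op_comp x i y) (inord (j + m)) z =
    ecast k (op_car k) (addnAC n p m) (op_comp (op_comp x j z) (inord i) y)
}.

Definition operad_isomorphic (K : fieldType) (O P : operad K) : Prop :=
  exists f : forall n, {linear O n -> P n},
    [/\ forall n, bijective (f n),
        f 0%N (op_one O) = op_one P
      & forall n m (x : O n) (i : 'I_n.+1) (y : O m),
          f (n + m)%N (op_comp x i y) = op_comp (f n x) i (f m y)].

Section Subspaces.
Variables (K : fieldType) (V : lmodType K).

Fact submodClosed_oppr (W : submodClosed V) : oppr_closed W.
Proof. by move=> x Wx; rewrite -scaleN1r rpredZ. Qed.

Definition zmodClosed_of (W : submodClosed V) : zmodClosed V :=
  HB.pack (GRing.SubmodClosed.sort W)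
    (GRing.isOppClosed.Build V W (@submodClosed_oppr W)).

Definition submod_of (W : submodClosed V) : predArgType := {x : V | x \in W}.
HB.instance Definition _ W := SubChoice.copy (submod_of W) {x : V | x \in W}.
HB.instance Definition _ W := [SubChoice_isSubLmodule of submod_of W by <:].

Definition span (X : V -> Prop) : {pred V} := fun x =>
  `[< forall W : submodClosed V, (forall y, X y -> y \in W) -> x \in W >].

Fact span_closed X : submod_closed (span X).
Proof.
split=> [|a x y /asboolP Wx /asboolP Wy]; apply/asboolP => W XW.
  exact: rpred0.
by rewrite rpredD ?rpredZ ?Wx ?Wy.
Qed.
HB.instance Definition _ X :=
  GRing.isSubmodClosed.Build K V (span X) (span_closed X).

End Subspaces.

Section QuotientSpace.
Variables (K : fieldType) (V : lmodType K) (W : submodClosed V).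

Definition submod_quot : Type :=
  Quotient.quot (zmodClosed_of W).
HB.instance Definition _ := EqQuotient.on submod_quot.
HB.instance Definition _ := GRing.Zmodule.on submod_quot.

Definition quot_pi (x : V) : submod_quot := \pi_submod_quot%qT x.
Definition quot_scale (a : K) (x : submod_quot) : submod_quot :=
  quot_pi (a *: repr x).

Lemma quot_piP x y : quot_pi x = quot_pi y <-> x - y \in W.
Proof.
by rewrite (Quotient.idealrBE (zmodClosed_of W)); split=> /eqP.
Qed.

Lemma quot_piK x : quot_pi (repr x) = x.
Proof. exact: reprK. Qed.

Lemma quot_piD x y : quot_pi (x + y) = quot_pi x + quot_pi y.
Proof. exact: (raddfD (\pi_submod_quot%qT)). Qed.

Lemma quot_piZ a x : quot_pi (a *: x) = quot_scale a (quot_pi x).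
Proof.
apply/quot_piP; rewrite -scalerBr rpredZ //.
by apply/quot_piP; rewrite quot_piK.
Qed.

Fact quot_scaleA a b x :
  quot_scale a (quot_scale b x) = quot_scale (a * b) x.
Proof. by rewrite -[x]quot_piK -!quot_piZ scalerA. Qed.

Fact quot_scale1 x : quot_scale 1 x = x.
Proof. by rewrite -[x]quot_piK -!quot_piZ scale1r. Qed.

Fact quot_scaleDr a (x y : submod_quot) :
  quot_scale a (x + y) = quot_scale a x + quot_scale a y.
Proof.
rewrite -[x]quot_piK -[y]quot_piK -quot_piD -!quot_piZ -quot_piD.
by rewrite scalerDr.
Qed.

Fact quot_scaleDl (x : submod_quot) a b :
  quot_scale (a + b) x = quot_scale a x + quot_scale b x.
Proof. by rewrite -[x]quot_piK -!quot_piZ -quot_piD scalerDl. Qed.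

HB.instance Definition _ := GRing.Zmodule_isLmodule.Build K submod_quot
  quot_scaleA quot_scale1 quot_scaleDr quot_scaleDl.

Fact quot_pi_linear : linear quot_pi.
Proof. by move=> a x y; rewrite quot_piD quot_piZ. Qed.
HB.instance Definition _ :=
  GRing.isLinear.Build K V submod_quot _ quot_pi quot_pi_linear.

End QuotientSpace.

Record suboperad (K : fieldType) (O : operad K) := Suboperad {
  sub_car :> forall n, submodClosed (O n);
  sub_one : op_one O \in sub_car 0%N;
  sub_comp : forall n m (x : O n) (i : 'I_n.+1) (y : O m),
    x \in sub_car n -> y \in sub_car m -> op_comp x i y \in sub_car (n + m)%N
}.

Section SubOperad.
Variables (K : fieldType) (O : operad K) (S : suboperad O).

Let car n : lmodType K := submod_of (S n).

Let one : car 0 := exist _ (op_one O) (sub_one S).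

Let comp n m (x : car n) (i : 'I_n.+1) (y : car m) : car (n + m) :=
  exist _ (op_comp (val x) i (val y)) (sub_comp i (valP x) (valP y)).

Fact val_cast n m (e : n = m) (x : car n) :
  val (ecast k (car k) e x) = ecast k (O k) e (val x).
Proof. by case: m / e. Qed.

Fact sub_linl n m (i : 'I_n.+1) (y : car m) :
  linear (fun x : car n => comp x i y).
Proof. by move=> a x x'; apply/val_inj; rewrite linearP; apply: op_linl. Qed.

Fact sub_linr n m (x : car n) (i : 'I_n.+1) :
  linear (fun y : car m => comp x i y).
Proof. by move=> a y y'; apply/val_inj; rewrite linearP; apply: op_linr. Qed.

Fact sub_one_comp m (x : car m) : comp one ord0 x = x.
Proof. by apply/val_inj; apply: op_one_comp. Qed.

Fact sub_comp_one n (x : car n) (i : 'I_n.+1) :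
  comp x i one = ecast k (car k) (esym (addn0 n)) x.
Proof. by apply/val_inj; rewrite val_cast; apply: op_comp_one. Qed.

Fact sub_seq n m p (x : car n) (y : car m) (z : car p)
    (i : 'I_n.+1) (j : 'I_m.+1) :
  comp (comp x i y) (inord (i + j)) z =
  ecast k (car k) (addnA n m p) (comp x i (comp y j z)).
Proof. by apply/val_inj; rewrite val_cast; apply: op_seq. Qed.

Fact sub_par n m p (x : car n) (y : car m) (z : car p) (i j : 'I_n.+1) :
  (i < j)%N ->
  comp (comp x i y) (inord (j + m)) z =
  ecast k (car k) (addnAC n p m) (comp (comp x j z) (inord i) y).
Proof. by move=> ij; apply/val_inj; rewrite val_cast; apply: op_par. Qed.

Definition sub_operad : operad K := Operad sub_linl sub_linr sub_one_comp
  sub_comp_one sub_seq sub_par.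

End SubOperad.

Section GeneratedSubOperad.
Variables (K : fieldType) (O : operad K) (X : forall n, O n -> Prop).

Definition gen_sub n : {pred O n} := fun x =>
  `[< forall S : suboperad O,
        (forall m (y : O m), X y -> y \in S m) -> x \in S n >].

Fact gen_sub_closed n : submod_closed (@gen_sub n).
Proof.
split=> [|a x y /asboolP Sx /asboolP Sy]; apply/asboolP => S XS.
  exact: rpred0.
by rewrite rpredD ?rpredZ ?Sx ?Sy.
Qed.
HB.instance Definition _ n :=
  GRing.isSubmodClosed.Build K (O n) (@gen_sub n) (@gen_sub_closed n).

Fact gen_sub_one : op_one O \in @gen_sub 0%N.
Proof. by apply/asboolP => S _; apply: sub_one. Qed.

Fact gen_sub_comp n m (x : O n) (i : 'I_n.+1) (y : O m) :
  x \in @gen_sub n -> y \in @gen_sub m -> op_comp x i y \in @gen_sub (n + m)%N.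
Proof.
move=> /asboolP Sx /asboolP Sy; apply/asboolP => S XS.
by apply: sub_comp; [apply: Sx | apply: Sy].
Qed.

Definition gen_suboperad : suboperad O :=
  @Suboperad K O (fun n => @gen_sub n) gen_sub_one gen_sub_comp.

End GeneratedSubOperad.

Record operad_ideal (K : fieldType) (O : operad K) := OperadIdeal {
  ideal_car :> forall n, submodClosed (O n);
  ideal_compl : forall n m (x : O n) (i : 'I_n.+1) (y : O m),
    x \in ideal_car n -> op_comp x i y \in ideal_car (n + m)%N;
  ideal_compr : forall n m (x : O n) (i : 'I_n.+1) (y : O m),
    y \in ideal_car m -> op_comp x i y \in ideal_car (n + m)%N
}.

Section GeneratedIdeal.
Variables (K : fieldType) (O : operad K) (X : forall n, {pred O n}).

Definition gen_id n : {pred O n} := fun x =>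
  `[< forall I : operad_ideal O,
        (forall m, {subset @X m <= I m}) -> x \in I n >].

Fact gen_id_closed n : submod_closed (@gen_id n).
Proof.
split=> [|a x y /asboolP Ix /asboolP Iy]; apply/asboolP => I XI.
  exact: rpred0.
by rewrite rpredD ?rpredZ ?Ix ?Iy.
Qed.
HB.instance Definition _ n :=
  GRing.isSubmodClosed.Build K (O n) (@gen_id n) (@gen_id_closed n).

Fact gen_id_compl n m (x : O n) (i : 'I_n.+1) (y : O m) :
  x \in @gen_id n -> op_comp x i y \in @gen_id (n + m)%N.
Proof. by move=> /asboolP Ix; apply/asboolP => I XI; apply/ideal_compl/Ix. Qed.

Fact gen_id_compr n m (x : O n) (i : 'I_n.+1) (y : O m) :
  y \in @gen_id m -> op_comp x i y \in @gen_id (n + m)%N.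
Proof. by move=> /asboolP Iy; apply/asboolP => I XI; apply/ideal_compr/Iy. Qed.

Definition gen_ideal : operad_ideal O :=
  @OperadIdeal K O (fun n => @gen_id n) gen_id_compl gen_id_compr.

End GeneratedIdeal.

Section QuotientOperad.
Variables (K : fieldType) (O : operad K) (I : operad_ideal O).

Let car n : lmodType K := submod_quot (I n).
Let pi n (x : O n) : car n := quot_pi (I n) x.

Let one : car 0 := pi (op_one O).

Let comp n m (x : car n) (i : 'I_n.+1) (y : car m) : car (n + m) :=
  pi (op_comp (repr x) i (repr y)).

Fact op_compBl n m (x x' : O n) (i : 'I_n.+1) (y : O m) :
  op_comp x i y - op_comp x' i y = op_comp (x - x') i y.
Proof.
rewrite addrC -scaleN1r [x - x']addrC -[- x']scaleN1r.
exact: esym (op_linl i y _ _ _).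
Qed.

Fact op_compBr n m (x : O n) (i : 'I_n.+1) (y y' : O m) :
  op_comp x i y - op_comp x i y' = op_comp x i (y - y').
Proof.
rewrite addrC -scaleN1r [y - y']addrC -[- y']scaleN1r.
exact: esym (op_linr x i _ _ _).
Qed.

Fact pi_comp n m (x : O n) (i : 'I_n.+1) (y : O m) :
  comp (pi x) i (pi y) = pi (op_comp x i y).
Proof.
apply/quot_piP; set x' := repr _; set y' := repr _.
have -> : op_comp x' i y' - op_comp x i y =
    op_comp (x' - x) i y' + op_comp x i (y' - y).
  by rewrite -op_compBl -op_compBr addrA addrNK.
apply: rpredD; [apply: ideal_compl | apply: ideal_compr];
  apply: (iffLR (quot_piP _ _ _)); exact: quot_piK.
Qed.

Fact pi_cast n m (e : n = m) (x : O n) :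
  pi (ecast k (O k) e x) = ecast k (car k) e (pi x).
Proof. by case: m / e. Qed.

Fact quot_surj n (x : car n) : exists y, x = pi y.
Proof. by exists (repr x); rewrite -[LHS]quot_piK. Qed.

Fact quot_linl n m (i : 'I_n.+1) (y : car m) :
  linear (fun x : car n => comp x i y).
Proof.
move=> a x x'; have [{}x ->] := quot_surj x; have [{}x' ->] := quot_surj x'.
have [{}y ->] := quot_surj y.
rewrite -[a *: pi x]linearZ -[_ + pi x']linearD /= !pi_comp.
by rewrite -linearP; congr (pi _); apply: op_linl.
Qed.

Fact quot_linr n m (x : car n) (i : 'I_n.+1) :
  linear (fun y : car m => comp x i y).
Proof.
move=> a y y'; have [{}y ->] := quot_surj y; have [{}y' ->] := quot_surj y'.
have [{}x ->] := quot_surj x.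
rewrite -[a *: pi y]linearZ -[_ + pi y']linearD /= !pi_comp.
by rewrite -linearP; congr (pi _); apply: op_linr.
Qed.

Fact quot_one_comp m (x : car m) : comp one ord0 x = x.
Proof. by have [{}x ->] := quot_surj x; rewrite pi_comp op_one_comp. Qed.

Fact quot_comp_one n (x : car n) (i : 'I_n.+1) :
  comp x i one = ecast k (car k) (esym (addn0 n)) x.
Proof.
by have [{}x ->] := quot_surj x; rewrite pi_comp op_comp_one pi_cast.
Qed.

Fact quot_seq n m p (x : car n) (y : car m) (z : car p)
    (i : 'I_n.+1) (j : 'I_m.+1) :
  comp (comp x i y) (inord (i + j)) z =
  ecast k (car k) (addnA n m p) (comp x i (comp y j z)).
Proof.
have [{}x ->] := quot_surj x; have [{}y ->] := quot_surj y.
have [{}z ->] := quot_surj z.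
by rewrite !pi_comp op_seq pi_cast.
Qed.

Fact quot_par n m p (x : car n) (y : car m) (z : car p) (i j : 'I_n.+1) :
  (i < j)%N ->
  comp (comp x i y) (inord (j + m)) z =
  ecast k (car k) (addnAC n p m) (comp (comp x j z) (inord i) y).
Proof.
move=> ij; have [{}x ->] := quot_surj x; have [{}y ->] := quot_surj y.
have [{}z ->] := quot_surj z.
by rewrite !pi_comp op_par // pi_cast.
Qed.

Definition quot_operad : operad K := Operad quot_linl quot_linr quot_one_comp
  quot_comp_one quot_seq quot_par.

End QuotientOperad.

Record set_operad := SetOperad {
  so_car :> nat -> choiceType;
  so_one : so_car 0;
  so_comp : forall n m, so_car n -> 'I_n.+1 -> so_car m -> so_car (n + m);
  so_one_comp : forall m (x : so_car m), so_comp so_one ord0 x = x;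
  so_comp_one : forall n (x : so_car n) (i : 'I_n.+1),
    so_comp x i so_one = ecast k (so_car k) (esym (addn0 n)) x;
  so_seq : forall n m p (x : so_car n) (y : so_car m) (z : so_car p)
      (i : 'I_n.+1) (j : 'I_m.+1),
    so_comp (so_comp x i y) (inord (i + j)) z =
    ecast k (so_car k) (addnA n m p) (so_comp x i (so_comp y j z));
  so_par : forall n m p (x : so_car n) (y : so_car m) (z : so_car p)
      (i j : 'I_n.+1), (i < j)%N ->
    so_comp (so_comp x i y) (inord (j + m)) z =
    ecast k (so_car k) (addnAC n p m) (so_comp (so_comp x j z) (inord i) y)
}.

Section LinearExtension.
Variables (K : fieldType) (T : choiceType) (V : lmodType K).

Definition malg_lift (h : T -> V) (f : {malg K[T]}) : V :=
  \sum_(t <- msupp f) f@_t *: h t.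

Lemma malg_liftE h (f : {malg K[T]}) (d : {fset T}) :
  (msupp f `<=` d)%fset -> malg_lift h f = \sum_(t <- d) f@_t *: h t.
Proof.
move=> fd; rewrite /malg_lift (big_fset_incl _ fd) //= => t _ /mcoeff_outdom ->.
by rewrite scale0r.
Qed.

Lemma malg_liftU h t : malg_lift h << t >> = h t.
Proof.
by rewrite /malg_lift msuppU oner_eq0 big_seq_fset1 mcoeffUU scale1r.
Qed.

Fact malg_lift_linear h : linear (malg_lift h).
Proof.
move=> a f g; pose d := (msupp f `|` msupp g)%fset.
rewrite !(@malg_liftE _ _ d) ?fsubsetUl ?fsubsetUr //; last first.
  apply: fsubset_trans (msuppD_le _ _) _.
  by apply: fsetUSS => //; apply: msuppZ_le.
rewrite scaler_sumr -big_split; apply: eq_bigr => t _ /=.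
by rewrite mcoeffD mcoeffZ scalerDl scalerA.
Qed.
HB.instance Definition _ h :=
  GRing.isLinear.Build K {malg K[T]} V _ (malg_lift h) (malg_lift_linear h).

Lemma malg_lift_linl (U : lmodType K) (h : U -> T -> V) f :
  (forall t, linear (h^~ t)) -> linear (fun u => malg_lift (h u) f).
Proof.
move=> hL a u v; rewrite /malg_lift scaler_sumr -big_split.
apply: eq_bigr => t _ /=; rewrite (hL t a u v) scalerDr !scalerA.
by rewrite mulrC.
Qed.

Lemma malg_linearE (f : {malg K[T]} -> V) :
  linear f -> f =1 malg_lift (fun t => f << t >>).
Proof.
move=> fL x.
have f0 : f 0 = 0 by have := fL (-1) 0 0; rewrite scaler0 addr0 scaleN1r addNr.
have fD : {morph f : u v / u + v}.
  by move=> u v; have := fL 1 u v; rewrite !scale1r.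
have fZ a u : f (a *: u) = a *: f u by rewrite -[_ *: u]addr0 fL f0 addr0.
rewrite {1}[x]monalgE (big_morph f fD f0); apply: eq_bigr => t _.
rewrite -fZ; congr f; apply/malgP => k.
by rewrite mcoeffZ !mcoeffU mulr_natr.
Qed.

Lemma malg_ind (f g : {malg K[T]} -> V) : linear f -> linear g ->
  (forall t, f << t >> = g << t >>) -> f =1 g.
Proof.
move=> fL gL fg x; rewrite (malg_linearE fL) (malg_linearE gL).
by apply: eq_bigr => t _; rewrite fg.
Qed.

End LinearExtension.

Section LinearSpan.
Variables (K : fieldType) (S : set_operad).

Let car n : lmodType K := {malg K[S n]}.

Let one : car 0 := << so_one S >>.

Let comp n m (x : car n) (i : 'I_n.+1) (y : car m) : car (n + m) :=
  malg_lift (fun u => malg_lift (fun v => << so_comp u i v >>) y) x.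

Fact lin_compU n m (u : S n) (i : 'I_n.+1) (v : S m) :
  comp << u >> i << v >> = << so_comp u i v >>.
Proof. by rewrite /comp !malg_liftU. Qed.

Fact lin_linl n m (i : 'I_n.+1) (y : car m) :
  linear (fun x : car n => comp x i y).
Proof. exact: malg_lift_linear. Qed.

Fact lin_linr n m (x : car n) (i : 'I_n.+1) :
  linear (fun y : car m => comp x i y).
Proof. by apply: malg_lift_linl => t; apply: malg_lift_linear. Qed.

Fact lin_castU n m (e : n = m) (u : S n) :
  ecast k (car k) e (<< u >> : car n) = << ecast k (S k) e u >>.
Proof. by case: m / e. Qed.

Fact lin_cast n m (e : n = m) :
  linear (fun x : car n => ecast k (car k) e x).
Proof. by case: m / e. Qed.

Fact linear_comp (U V W : lmodType K) (f : V -> W) (g : U -> V) :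
  linear f -> linear g -> linear (fun x => f (g x)).
Proof. by move=> fL gL a u v; rewrite gL fL. Qed.

Fact lin_one_comp m (x : car m) : comp one ord0 x = x.
Proof.
apply: (malg_ind (f := comp one ord0) (g := id)) => //; first exact: lin_linr.
by move=> t; rewrite lin_compU so_one_comp.
Qed.

Fact lin_comp_one n (x : car n) (i : 'I_n.+1) :
  comp x i one = ecast k (car k) (esym (addn0 n)) x.
Proof.
apply: (malg_ind (f := fun x => comp x i one)
  (g := fun x => ecast k (car k) (esym (addn0 n)) x)); first exact: lin_linl.
  exact: lin_cast.
by move=> t; rewrite lin_compU so_comp_one lin_castU.
Qed.

Fact lin_seq n m p (x : car n) (y : car m) (z : car p)
    (i : 'I_n.+1) (j : 'I_m.+1) :
  comp (comp x i y) (inord (i + j)) z =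
  ecast k (car k) (addnA n m p) (comp x i (comp y j z)).
Proof.
pose l (x : car n) (y : car m) (z : car p) :=
  comp (comp x i y) (inord (i + j)) z.
pose r (x : car n) (y : car m) (z : car p) :=
  ecast k (car k) (addnA n m p) (comp x i (comp y j z)).
refine (malg_ind (f := fun x0 : car n => l x0 y z)
  (g := fun x0 : car n => r x0 y z) _ _ _ x) => [||u].
- by apply: (linear_comp (lin_linl _ _)) => // ; apply: lin_linl.
- by apply: linear_comp (lin_cast _) _; apply: lin_linl.
refine (malg_ind (f := fun y0 : car m => l _ y0 z)
  (g := fun y0 : car m => r _ y0 z) _ _ _ y) => [||v].
- by apply: (linear_comp (lin_linl _ _)); apply: lin_linr.
- apply: linear_comp (lin_cast _) _.
  by apply: (linear_comp (lin_linr _ _)); apply: lin_linl.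
refine (malg_ind (f := fun z0 : car p => l _ _ z0)
  (g := fun z0 : car p => r _ _ z0) _ _ _ z) => [||w].
- exact: lin_linr.
- apply: linear_comp (lin_cast _) _.
  by apply: (linear_comp (lin_linr _ _)); apply: lin_linr.
by rewrite /l /r !lin_compU so_seq lin_castU.
Qed.

Fact lin_par n m p (x : car n) (y : car m) (z : car p) (i j : 'I_n.+1) :
  (i < j)%N ->
  comp (comp x i y) (inord (j + m)) z =
  ecast k (car k) (addnAC n p m) (comp (comp x j z) (inord i) y).
Proof.
move=> ij; pose l (x : car n) (y : car m) (z : car p) :=
  comp (comp x i y) (inord (j + m)) z.
pose r (x : car n) (y : car m) (z : car p) :=
  ecast k (car k) (addnAC n p m) (comp (comp x j z) (inord i) y).
refine (malg_ind (f := fun x0 : car n => l x0 y z)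
  (g := fun x0 : car n => r x0 y z) _ _ _ x) => [||u].
- by apply: (linear_comp (lin_linl _ _)); apply: lin_linl.
- apply: linear_comp (lin_cast _) _.
  by apply: (linear_comp (lin_linl _ _)); apply: lin_linl.
refine (malg_ind (f := fun y0 : car m => l _ y0 z)
  (g := fun y0 : car m => r _ y0 z) _ _ _ y) => [||v].
- by apply: (linear_comp (lin_linl _ _)); apply: lin_linr.
- by apply: linear_comp (lin_cast _) _; apply: lin_linr.
refine (malg_ind (f := fun z0 : car p => l _ _ z0)
  (g := fun z0 : car p => r _ _ z0) _ _ _ z) => [||w].
- exact: lin_linr.
- apply: linear_comp (lin_cast _) _.
  by apply: (linear_comp (lin_linl _ _)); apply: lin_linr.
by rewrite /l /r !lin_compU so_par // lin_castU.
Qed.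

Definition lin_operad : operad K := Operad lin_linl lin_linr lin_one_comp
  lin_comp_one lin_seq lin_par.

End LinearSpan.

Section WordOperad.
Variable gamma : nat.
Local Notation M := 'I_gamma.+1.

Definition word n : choiceType := n.+1.-tuple M.

Definition word_ins (u : seq M) (i : nat) (a : M) (v : seq M) : seq M :=
  take i u ++ [seq Order.max a x | x <- v] ++ drop i.+1 u.

Fact size_word_ins n m (u : word n) (i : 'I_n.+1) a (v : word m) :
  size (word_ins u i a v) == (n + m).+1.
Proof.
rewrite !size_cat size_map size_take size_drop !size_tuple ltn_ord.
by rewrite addnCA subSS subnKC -1?ltnS // addnC addnS.
Qed.

Definition word_comp n m (u : word n) (i : 'I_n.+1) (v : word m) :
  word (n + m) := Tuple (size_word_ins u i (tnth u i) v).

Definition word_one : word 0 := [tuple ord0].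

Fact max0x (x : M) : Order.max (ord0 : M) x = x.
Proof. exact/max_r/leq0n. Qed.

Fact maxx0 (x : M) : Order.max x (ord0 : M) = x.
Proof. exact/max_l/leq0n. Qed.

Fact word_insE (u1 u2 : seq M) a b v i : i = size u1 ->
  word_ins (u1 ++ a :: u2) i b v = u1 ++ [seq Order.max b x | x <- v] ++ u2.
Proof.
move=> ->; rewrite /word_ins take_size_cat // -cat_rcons.
by rewrite drop_size_cat ?size_rcons.
Qed.

Fact word_compE n m (u : word n) (i : 'I_n.+1) (v : word m) u1 a u2 :
  u = u1 ++ a :: u2 :> seq M -> i = size u1 :> nat ->
  word_comp u i v = u1 ++ [seq Order.max a x | x <- v] ++ u2 :> seq M.
Proof.
move=> uE iE; rewrite /= (tnth_nth ord0) uE word_insE // iE nth_cat ltnn.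
by rewrite subnn.
Qed.

Fact word_split n (u : word n) (i : 'I_n.+1) :
  exists u1 a u2, u = u1 ++ a :: u2 :> seq M /\ i = size u1 :> nat.
Proof.
exists (take i u), (tnth u i), (drop i.+1 u).
rewrite size_takel ?size_tuple 1?ltnW //; split=> //.
by rewrite (tnth_nth ord0) -drop_nth ?size_tuple // cat_take_drop.
Qed.

Fact word_cast n m (e : n = m) (u : word n) :
  ecast k (word k) e u = u :> seq M.
Proof. by case: m / e. Qed.

Fact word_inj n (u v : word n) : u = v :> seq M -> u = v.
Proof. exact: val_inj. Qed.

Fact word_one_comp m (u : word m) : word_comp word_one ord0 u = u.
Proof.
apply: word_inj; rewrite (@word_compE _ _ _ _ _ [::] ord0 [::]) //=.
by rewrite cats0 (eq_map max0x) map_id.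
Qed.

Fact word_comp_one n (u : word n) (i : 'I_n.+1) :
  word_comp u i word_one = ecast k (word k) (esym (addn0 n)) u.
Proof.
apply: word_inj; rewrite word_cast.
have [u1 [a [u2 [uE iE]]]] := word_split u i.
by rewrite (word_compE _ uE iE) /= maxx0 -uE.
Qed.

Fact word_seq n m p (u : word n) (v : word m) (w : word p)
    (i : 'I_n.+1) (j : 'I_m.+1) :
  word_comp (word_comp u i v) (inord (i + j)) w =
  ecast k (word k) (addnA n m p) (word_comp u i (word_comp v j w)).
Proof.
apply: word_inj; rewrite word_cast.
have [u1 [a [u2 [uE iE]]]] := word_split u i.
have [v1 [b [v2 [vE jE]]]] := word_split v j.
rewrite (word_compE _ uE iE) (word_compE w vE jE).
have uvE : word_comp u i v = (u1 ++ [seq Order.max a x | x <- v1]) ++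
    Order.max a b :: ([seq Order.max a x | x <- v2] ++ u2) :> seq M.
  by rewrite (word_compE _ uE iE) vE map_cat /= -!catA.
rewrite (word_compE _ uvE) ?inordK ?size_cat ?size_map ?iE ?jE //.
  by rewrite !map_cat -!catA -map_comp; do 2!congr (_ ++ _);
     congr (_ ++ _); apply: eq_map => x /=; rewrite maxA.
by rewrite -iE -jE ltnS leq_add // -ltnS.
Qed.

Fact word_par n m p (u : word n) (v : word m) (w : word p) (i j : 'I_n.+1) :
  (i < j)%N ->
  word_comp (word_comp u i v) (inord (j + m)) w =
  ecast k (word k) (addnAC n p m) (word_comp (word_comp u j w) (inord i) v).
Proof.
move=> ij; apply: word_inj; rewrite word_cast.
have [u1 [b [u2 [uE jE]]]] := word_split u j.
have [u11 [a [u12 [u1E iE]]]] :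
  exists x a y, u1 = x ++ a :: y /\ i = size x :> nat.
  exists (take i u1), (nth ord0 u1 i), (drop i.+1 u1).
  by rewrite size_takel -?jE 1?ltnW // -drop_nth -?jE // cat_take_drop.
have uE' : u = u11 ++ a :: (u12 ++ b :: u2) :> seq M by rewrite uE u1E -catA.
have E1 : word_comp u i v = (u11 ++ [seq Order.max a x | x <- v] ++ u12) ++
    b :: u2 :> seq M by rewrite (word_compE _ uE' iE) -!catA.
have E2 : word_comp u j w = u11 ++ a :: (u12 ++ [seq Order.max b x | x <- w]
    ++ u2) :> seq M by rewrite (word_compE _ uE jE) u1E -!catA.
have lei : (i < (n + p).+1)%N by case: (i) (ltn_ord i) => /=; lia.
have lej : (j + m < (n + m).+1)%N by case: (j) (ltn_ord j) => /=; lia.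
rewrite (word_compE w E1) ?(word_compE v E2) ?inordK //.
  by rewrite -!catA.
by rewrite !size_cat size_map size_tuple jE u1E size_cat /=; lia.
Qed.

Definition word_operad : set_operad :=
  SetOperad word_one_comp word_comp_one word_seq word_par.

End WordOperad.

Inductive bintree (G : Type) : Type :=
| Leaf
| Node of G & bintree G & bintree G.
Arguments Leaf {G}.

Section TreeChoice.
Variable G : choiceType.

Fixpoint bintree_encode (t : bintree G) : GenTree.tree G :=
  if t is Node g l r then
    GenTree.Node 1 [:: GenTree.Leaf g; bintree_encode l; bintree_encode r]
  else GenTree.Node 0 [::].

Fixpoint bintree_decode (t : GenTree.tree G) : option (bintree G) :=
  match t with
  | GenTree.Node _ [:: GenTree.Leaf g; l; r] =>
      if bintree_decode l is Some l' then
        omap (Node g l') (bintree_decode r)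
      else None
  | _ => Some Leaf
  end.

Fact bintree_encodeK : pcancel bintree_encode bintree_decode.
Proof. by elim=> //= g l -> r ->. Qed.

HB.instance Definition _ := Choice.copy (bintree G) (pcan_type bintree_encodeK).

End TreeChoice.

Section FreeOperad.
Variable G : choiceType.

Fixpoint leaves (t : bintree G) : nat :=
  if t is Node _ l r then leaves l + leaves r else 1.

Fixpoint graft (s : bintree G) (i : nat) (t : bintree G) : bintree G :=
  if s is Node g l r then
    if (i < leaves l)%N then Node g (graft l i t) r
    else Node g l (graft r (i - leaves l) t)
  else t.

Definition tree n : choiceType := {t : bintree G | leaves t == n.+1}.

Fact leaves_gt0 t : (0 < leaves t)%N.
Proof. by elim: t => //= g l hl r hr; rewrite addn_gt0 hl. Qed.

Fact leaves_graft s i t : (i < leaves s)%N ->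
  leaves (graft s i t) = (leaves s + leaves t).-1.
Proof.
elim: s i => [|g l IHl r IHr] i /=; first by [].
have l0 := leaves_gt0 l; have r0 := leaves_gt0 r; have t0 := leaves_gt0 t.
by have [il|il] := ltnP i (leaves l) => ir /=; rewrite ?IHl ?IHr; lia.
Qed.

Fact graft_leaf s i : graft s i Leaf = s.
Proof. by elim: s i => //= g l IHl r IHr i; case: ifP; rewrite ?IHl ?IHr. Qed.

Fact graft_seq s i t j r : (i < leaves s)%N -> (j < leaves t)%N ->
  graft (graft s i t) (i + j) r = graft s i (graft t j r).
Proof.
elim: s i => [|g l IHl l' IHr] i /= il jt; first by case: i il.
have [ill|lli] := ltnP i (leaves l) => /=.
  by rewrite leaves_graft // ifT ?IHl //; lia.
by rewrite ifF -?addnBAC ?IHr //; lia.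
Qed.

Fact graft_par s i t j r : (i < j < leaves s)%N ->
  graft (graft s i t) (j + (leaves t).-1) r = graft (graft s j r) i t.
Proof.
have t0 := leaves_gt0 t; have r0 := leaves_gt0 r.
elim: s i j => [|g l IHl l' IHr] i j /= ij; first lia.
have [jl|lj] := ltnP j (leaves l).
  have il : (i < leaves l)%N by lia.
  rewrite il /= !leaves_graft // !ifT; [|lia..].
  by rewrite IHl //; lia.
have [il|li] := ltnP i (leaves l) => /=.
  rewrite leaves_graft // il ifF; last lia.
  by congr (Node _ _ (graft _ _ _)); lia.
rewrite !ifF; [|lia..]; congr (Node _ _ _); rewrite -IHr; last lia.
by congr graft; lia.
Qed.

Definition tree_one : tree 0 := exist (fun t => leaves t == 1%N) Leaf (eqxx _).

Fact leaves_tree_comp n m (s : tree n) (i : 'I_n.+1) (t : tree m) :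
  leaves (graft (val s) i (val t)) == (n + m).+1.
Proof.
have /eqP hs := valP s; have /eqP ht := valP t.
by rewrite leaves_graft hs // ht addSn addnS.
Qed.

Definition tree_comp n m (s : tree n) (i : 'I_n.+1) (t : tree m) :
  tree (n + m) :=
  exist (fun t => leaves t == (n + m).+1) _ (leaves_tree_comp s i t).

Fact tree_cast n m (e : n = m) (t : tree n) :
  val (ecast k (tree k) e t) = val t.
Proof. by case: m / e. Qed.

Fact tree_one_comp m (t : tree m) : tree_comp tree_one ord0 t = t.
Proof. exact: val_inj. Qed.

Fact tree_comp_one n (t : tree n) (i : 'I_n.+1) :
  tree_comp t i tree_one = ecast k (tree k) (esym (addn0 n)) t.
Proof. by apply: val_inj; rewrite tree_cast /= graft_leaf. Qed.

Fact tree_seq n m p (s : tree n) (t : tree m) (r : tree p)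
    (i : 'I_n.+1) (j : 'I_m.+1) :
  tree_comp (tree_comp s i t) (inord (i + j)) r =
  ecast k (tree k) (addnA n m p) (tree_comp s i (tree_comp t j r)).
Proof.
apply: val_inj; rewrite tree_cast /= inordK; last first.
  by rewrite ltnS leq_add // -ltnS.
by rewrite graft_seq // ?(eqP (valP s)) ?(eqP (valP t)).
Qed.

Fact tree_par n m p (s : tree n) (t : tree m) (r : tree p) (i j : 'I_n.+1) :
  (i < j)%N ->
  tree_comp (tree_comp s i t) (inord (j + m)) r =
  ecast k (tree k) (addnAC n p m) (tree_comp (tree_comp s j r) (inord i) t).
Proof.
move=> ij; apply: val_inj; rewrite tree_cast /= !inordK.
- have tm : (leaves (val t)).-1 = m by rewrite (eqP (valP t)).
  have := @graft_par (val s) i (val t) j (val r); rewrite tm; apply.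
  by rewrite ij (eqP (valP s)) ltn_ord.
- by case: (i) (ltn_ord i) => /=; lia.
- by case: (j) (ltn_ord j) => /=; lia.
Qed.

Definition tree_operad : set_operad :=
  SetOperad tree_one_comp tree_comp_one tree_seq tree_par.

Definition corolla (g : G) : tree 1 :=
  exist (fun t => leaves t == 2) (Node g Leaf Leaf) (eqxx _).

End FreeOperad.

Definition free_operad (K : fieldType) (G : choiceType) : operad K :=
  lin_operad K (tree_operad G).

Section Presentations.
Variables (K : fieldType) (G : choiceType).

Definition admits_presentation (O : operad K)
    (R : forall n, submodClosed (free_operad K G n)) : Prop :=
  operad_isomorphic O (quot_operad (gen_ideal R)).

Definition relation_space (rel : forall n, tree G n -> tree G n -> Prop) n :
    submodClosed (free_operad K G n) :=
  span (fun f : {malg K[tree G n]} =>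
    exists t t' : tree G n, rel n t t' /\ f = << t >> - << t' >>).

End Presentations.

Section Dias.
Variables (K : fieldType) (gamma : nat).

(* An element a : 'I_gamma stands for the integer a + 1 of {1, ..., gamma};
   lift ord0 a is the letter a + 1 of {0, ..., gamma}.                        *)
Definition letter (a : 'I_gamma) : 'I_gamma.+1 := lift ord0 a.

Definition TM : operad K := lin_operad K (word_operad gamma).

Inductive dias_word : forall n, TM n -> Prop :=
| dias_word_0a (a : 'I_gamma) : @dias_word 1 << [tuple ord0; letter a] >>
| dias_word_a0 (a : 'I_gamma) : @dias_word 1 << [tuple letter a; ord0] >>.

Definition Dias : operad K := sub_operad (gen_suboperad dias_word).

End Dias.

Section DiasRelations.
Variable gamma : nat.

Definition dias_gen : choiceType := ('I_gamma + 'I_gamma)%type.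

(* The intended images of dashv a and vdash a are the words 0a and a0.        *)
Definition dashv (a : 'I_gamma) : tree dias_gen 1 := corolla (inl a).
Definition vdash (a : 'I_gamma) : tree dias_gen 1 := corolla (inr a).

Local Notation "x \o1 y" := (tree_comp x (@ord0 1) y) (at level 50).
Local Notation "x \o2 y" := (tree_comp x (@ord_max 1) y) (at level 50).

Inductive dias_rel0 : forall n, tree dias_gen n -> tree dias_gen n -> Prop :=
| dias_rel_LR (a a' : 'I_gamma) :
    @dias_rel0 2 (dashv a \o1 vdash a') (vdash a' \o2 dashv a)
| dias_rel_LLR (a b : 'I_gamma) : (a < b)%N ->
    @dias_rel0 2 (dashv a \o1 dashv b) (dashv a \o2 vdash b)
| dias_rel_RLR (a b : 'I_gamma) : (a < b)%N ->
    @dias_rel0 2 (vdash a \o1 dashv b) (vdash a \o2 vdash b)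
| dias_rel_LLL (a b : 'I_gamma) : (a < b)%N ->
    @dias_rel0 2 (dashv b \o1 dashv a) (dashv a \o2 dashv b)
| dias_rel_RRR (a b : 'I_gamma) : (a < b)%N ->
    @dias_rel0 2 (vdash a \o1 vdash b) (vdash b \o2 vdash a)
| dias_rel_Ldd_Ldc (c d : 'I_gamma) : (c <= d)%N ->
    @dias_rel0 2 (dashv d \o1 dashv d) (dashv d \o2 dashv c)
| dias_rel_Ldc_LRc (c d : 'I_gamma) : (c <= d)%N ->
    @dias_rel0 2 (dashv d \o2 dashv c) (dashv d \o2 vdash c)
| dias_rel_RLc_RRc (c d : 'I_gamma) : (c <= d)%N ->
    @dias_rel0 2 (vdash d \o1 dashv c) (vdash d \o1 vdash c)
| dias_rel_RRc_Rdd (c d : 'I_gamma) : (c <= d)%N ->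
    @dias_rel0 2 (vdash d \o1 vdash c) (vdash d \o2 vdash d).

(* The least equivalence relation containing the listed pairs; it is trivial
   outside the trees with 3 leaves.                                           *)
Definition dias_rel n : tree dias_gen n -> tree dias_gen n -> Prop :=
  clos_refl_sym_trans (tree dias_gen n) (@dias_rel0 n).

End DiasRelations.

(* Main.v *)
(** Sending [dashv a] to [0a] and [vdash a] to [a0] maps a tree to a word with
    exactly one letter [0], and the relations hold between the images.
    Conversely, by induction on [t], the relations move all the nodes of [t] in
    [x dashv_a t] onto a left comb [(..(x dashv_c1 |) ..) dashv_ck |], where
    [c1 .. ck] is the word of [t] with every letter replaced by its maximum with
    [a]; dually for [vdash].  Hence a tree whose word is [u 0 v] is equivalent to
    a right comb of [vdash]'s labeled by [u] carrying a left comb of [dashv]'s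
    labeled by [v], and trees with the same word are equivalent. *)

Require Import Defs.
From HB Require Import structures.
From mathcomp Require Import all_boot all_order all_algebra.
From mathcomp Require Import zify finmap boolp.
From mathcomp.multinomials Require Import monalg.
From Stdlib Require Import Relation_Operators.

Set Implicit Arguments.
Unset Strict Implicit.
Unset Printing Implicit Defensive.

Import Order.TTheory GRing.Theory.
Local Open Scope ring_scope.

(** * First isomorphism theorem for operads *)

Section FirstIsomorphism.
Variables (K : fieldType) (O P : operad K).
Variable phi : forall n, {linear O n -> P n}.
Hypothesis phi_one : phi 0 (op_one O) = op_one P.
Hypothesis phi_comp : forall n m (x : O n) (i : 'I_n.+1) (y : O m),
  phi (n + m)%N (op_comp x i y) = op_comp (phi n x) i (phi m y).
Hypothesis phi_surj : forall n (y : P n), exists x, phi n x == y.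
Variable I : operad_ideal O.
Hypothesis phi_ker : forall n (x : O n), phi n x = 0 <-> x \in I n.

(** This is the future isomorphism: two preimages of [y] differ by an element of the kernel, so the
    class does not depend on the choice. Surjectivity is stated with [==] so that [xchoose]
    applies. *)
Let lift n (y : P n) : quot_operad I n := quot_pi (I n) (xchoose (phi_surj y)).

Let lift_phi n (x : O n) : lift (phi n x) = quot_pi (I n) x.
Proof.
apply/quot_piP/phi_ker; rewrite linearB /=.
by rewrite (eqP (xchooseP (phi_surj (phi n x)))) subrr.
Qed.

Let phiP n (y : P n) : exists x, y = phi n x.
Proof. by have [x /eqP <-] := phi_surj y; exists x. Qed.

Let lift_linear n : linear (@lift n).
Proof.
move=> a y y'; have [x ->] := phiP y; have [x' ->] := phiP y'.
by rewrite -linearP !lift_phi linearP.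
Qed.

HB.instance Definition _ n :=
  GRing.isLinear.Build K (P n) (quot_operad I n) _ (@lift n) (@lift_linear n).

Lemma first_isomorphism : operad_isomorphic P (quot_operad I).
Proof.
exists (fun n => (@lift n : {linear P n -> quot_operad I n})); split.
(* The inverse applies [phi] to a representative of the class. *)
- move=> n; exists (fun q : quot_operad I n => phi n (repr q)) => [y|q] /=.
    have [x ->] := phiP y; rewrite lift_phi; apply/eqP; rewrite -subr_eq0.
    rewrite -linearB /=; apply/eqP/phi_ker.
    by apply/(quot_piP (I n)); rewrite quot_piK.
  by rewrite lift_phi quot_piK.
- by rewrite /= -phi_one lift_phi.
- move=> n m y i z /=; have [x ->] := phiP y; have [x' ->] := phiP z.
  by rewrite -phi_comp !lift_phi pi_comp.
Qed.

End FirstIsomorphism.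

(** * Linear spans: kernels of maps between bases, composition of basis vectors *)

(** By [hW], the class of [<< s >>] modulo [W] depends only on [h s]. The projection onto the
    quotient by [W] therefore factors through the linear extension of [h], whose kernel must then
    lie in [W]. *)
Lemma malg_map_ker (K : fieldType) (S T : choiceType) (h : S -> T)
    (W : submodClosed {malg K[S]}) (x : {malg K[S]}) :
    (forall s s', h s = h s' -> << s >> - << s' >> \in W) ->
  malg_lift (fun s => << h s >> : {malg K[T]}) x = 0 -> x \in W.
Proof.
move=> hW hx0.
(* The factor: [t] goes to the class of one chosen preimage under [h]. The value 0 outside the image
   of [h] is never met. *)
pose sec t : submod_quot W :=
  if pselect (exists s, h s = t) is left ex then quot_pi W << projT1 (cid ex) >>
  else 0.
have secE : malg_lift sec (malg_lift (fun s => << h s >>) x) = quot_pi W x.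
  move: x {hx0}; apply: malg_ind => [a x y|a x y|s]; rewrite ?linearP //.
  rewrite !malg_liftU /sec; case: pselect => [ex|[]]; last by exists s.
  by apply/quot_piP; apply: hW; case: cid.
by rewrite -[x]subr0; apply/quot_piP; rewrite -secE hx0 !linear0.
Qed.

Definition op_basis (K : fieldType) (S : set_operad) n (x : S n) :
  lin_operad K S n := << x >>.

Lemma op_basis_comp (K : fieldType) (S : set_operad) n m (x : S n) (i : 'I_n.+1)
    (y : S m) :
  op_comp (op_basis K x) i (op_basis K y) = op_basis K (so_comp x i y).
Proof. exact: lin_compU. Qed.

(* Naming the basis vectors of each concrete operad keeps rewriting from
   unfolding [lin_operad]. *)
Definition free_basis (K : fieldType) (G : choiceType) n (t : tree G n) :
  free_operad K G n := @op_basis K (tree_operad G) n t.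

Lemma free_basis_comp (K : fieldType) (G : choiceType) n m (s : tree G n)
    (i : 'I_n.+1) (t : tree G m) :
  op_comp (free_basis K s) i (free_basis K t) = free_basis K (tree_comp s i t).
Proof. exact: (@op_basis_comp K (tree_operad G)). Qed.

Lemma free_basis_compBr (K : fieldType) (G : choiceType) n m (s : tree G n)
    (i : 'I_n.+1) (t t' : tree G m) :
  op_comp (free_basis K s) i (free_basis K t - free_basis K t') =
  free_basis K (tree_comp s i t) - free_basis K (tree_comp s i t').
Proof.
apply: etrans (esym (op_compBr _ _ _ _)) _.
by congr (_ - _); apply: free_basis_comp.
Qed.

Lemma free_basis_compBl (K : fieldType) (G : choiceType) n m (s s' : tree G n)
    (i : 'I_n.+1) (t : tree G m) :
  op_comp (free_basis K s - free_basis K s') i (free_basis K t) =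
  free_basis K (tree_comp s i t) - free_basis K (tree_comp s' i t).
Proof.
apply: etrans (esym (op_compBl _ _ _ _)) _.
by congr (_ - _); apply: free_basis_comp.
Qed.

Definition word_basis (K : fieldType) gamma n (u : word gamma n) :
  TM K gamma n := @op_basis K (word_operad gamma) n u.

Lemma word_basis_comp (K : fieldType) gamma n m (u : word gamma n)
    (i : 'I_n.+1) (v : word gamma m) :
  op_comp (word_basis K u) i (word_basis K v) = word_basis K (word_comp u i v).
Proof. exact: (@op_basis_comp K (word_operad gamma)). Qed.

(** * The congruence on trees defined by an operad ideal *)

Section TreeEquivalence.
Variables (K : fieldType) (G : choiceType) (I : operad_ideal (free_operad K G)).

(** Stated on bare trees with the arity existentially quantified, so that chaining equivalences and
    passing to subtrees require no casts between arities. *)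
Definition tree_equiv (s t : bintree G) : Prop :=
  exists n (s' t' : tree G n),
    [/\ s = val s', t = val t' & free_basis K s' - free_basis K t' \in I n].

Lemma tree_equivP n (s t : tree G n) :
  tree_equiv (val s) (val t) <-> free_basis K s - free_basis K t \in I n.
Proof.
split=> [[m [s' [t' [es et]]]]|]; last by exists n, s, t.
have e : m = n by apply: succn_inj; rewrite -(eqP (valP s)) es (eqP (valP s')).
by case: n / e s t es et => s t /val_inj -> /val_inj ->.
Qed.

Lemma tree_equiv_refl t : tree_equiv t t.
Proof.
have et : leaves t == (leaves t).-1.+1 by rewrite prednK // leaves_gt0.
by exists _, (exist _ t et), (exist _ t et); split; rewrite // subrr rpred0.
Qed.

Lemma tree_equiv_sym s t : tree_equiv s t -> tree_equiv t s.
Proof.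
case=> n [s' [t' [-> -> st]]]; apply/tree_equivP.
by rewrite -opprB -scaleN1r rpredZ.
Qed.

Lemma tree_equiv_trans s t r :
  tree_equiv s t -> tree_equiv t r -> tree_equiv s r.
Proof.
case=> n [s' [t' [-> -> st]]] [m [t2 [r' [e -> tr]]]].
have en : m = n by apply: succn_inj; rewrite -(eqP (valP t')) e (eqP (valP t2)).
case: n / en s' t' st e => s' t' st /val_inj e; subst t2.
by apply/tree_equivP; have := rpredD st tr; rewrite addrA subrK.
Qed.

Lemma tree_equiv_graftr s i t t' : (i < leaves s)%N ->
  tree_equiv t t' -> tree_equiv (graft s i t) (graft s i t').
Proof.
move=> si [m [t1 [t2 [-> -> tt]]]].
have es : leaves s == (leaves s).-1.+1 by rewrite prednK // leaves_gt0.
have si' : (i < (leaves s).-1.+1)%N by rewrite -(eqP es).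
pose s1 : tree G (leaves s).-1 := exist _ s es.
apply/(tree_equivP (tree_comp s1 (Ordinal si') t1)
  (tree_comp s1 (Ordinal si') t2)).
rewrite -free_basis_compBr; exact: ideal_compr.
Qed.

Lemma tree_equiv_graftl s s' i t : (i < leaves s)%N ->
  tree_equiv s s' -> tree_equiv (graft s i t) (graft s' i t).
Proof.
move=> si [m [s1 [s2 [es -> ss]]]]; move: si.
rewrite {s}es (eqP (valP s1)) => si.
have et : leaves t == (leaves t).-1.+1 by rewrite prednK // leaves_gt0.
pose t1 : tree G (leaves t).-1 := exist _ t et.
apply/(tree_equivP (tree_comp s1 (Ordinal si) t1)
  (tree_comp s2 (Ordinal si) t1)).
rewrite -free_basis_compBl; exact: ideal_compl.
Qed.

(** A node is the corolla of [g] with [r] grafted on leaf 1, then [l] on leaf 0, so compatibility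
    with grafting suffices, one child at a time. *)
Lemma tree_equiv_node g l l' r r' :
  tree_equiv l l' -> tree_equiv r r' -> tree_equiv (Node g l r) (Node g l' r').
Proof.
move=> ll rr; pose c := Node g (Leaf : bintree G) Leaf.
apply: (@tree_equiv_trans _ (Node g l' r)).
  by apply: (@tree_equiv_graftr (graft c 1 r) 0 l l').
by apply: (@tree_equiv_graftl (graft c 1 r) (graft c 1 r') 0 l' _
  (@tree_equiv_graftr c 1 r r' _ rr)).
Qed.

(** This turns a relation between trees with three leaves into a rewriting rule with arbitrary
    subtrees. Grafting from right to left leaves the remaining leaf positions unshifted. *)
Lemma tree_equiv_subst3 (s t : tree G 2) x y z :
  free_basis K s - free_basis K t \in I 2%N ->
  tree_equiv (graft (graft (graft (val s) 2 z) 1 y) 0 x)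
    (graft (graft (graft (val t) 2 z) 1 y) 0 x).
Proof.
move=> /tree_equivP st; have s3 := eqP (valP s).
have := leaves_gt0 x; have := leaves_gt0 y; have := leaves_gt0 z => x0 y0 z0.
by do 3!(apply: tree_equiv_graftl; first by rewrite ?leaves_graft ?s3 //; lia).
Qed.

End TreeEquivalence.

(** * The word of a tree and soundness of the relations *)

Section Words.
Variable gamma : nat.
Local Notation M := 'I_gamma.+1.
Local Notation G := (dias_gen gamma).
Local Notation L a := (Node (inl a : G)).
Local Notation R a := (Node (inr a : G)).

Definition gen_letters (g : G) : M * M :=
  match g with inl a => (ord0, letter a) | inr a => (letter a, ord0) end.

(** This evaluates the tree in [TM]: a leaf is the unit word 0, and each generator is replaced by
    its word [0a] or [a0]. *)
Fixpoint bword (t : bintree G) : seq M :=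
  if t is Node g l r then
    [seq Order.max (gen_letters g).1 x | x <- bword l] ++
    [seq Order.max (gen_letters g).2 x | x <- bword r]
  else [:: ord0].

Lemma size_bword t : size (bword t) = leaves t.
Proof. by elim: t => //= g l IHl r IHr; rewrite size_cat !size_map IHl IHr. Qed.

Lemma map_max_max (a b : M) s :
  [seq Order.max a x | x <- [seq Order.max b x | x <- s]] =
  [seq Order.max (Order.max a b) x | x <- s].
Proof. by rewrite -map_comp; apply: eq_map => x /=; rewrite maxA. Qed.

Lemma map_max0 (s : seq M) : [seq Order.max ord0 x | x <- s] = s.
Proof. by rewrite (eq_map (@max0x _)) map_id. Qed.

(** A letter is the maximum of the contributions met on the path from the root to its leaf. Grafting
    concatenates paths, and associativity of the maximum gives the formula. *)
Lemma bword_graft s i t : (i < leaves s)%N ->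
  bword (graft s i t) = word_ins (bword s) i (nth ord0 (bword s) i) (bword t).
Proof.
elim: s i => [|g l IHl r IHr] i /=.
  by case: i => // _; rewrite /word_ins /= map_max0 cats0.
move=> ilt; rewrite /word_ins nth_cat take_cat drop_cat !size_map size_bword.
have [il|li] := ltnP i (leaves l) => /=.
  rewrite IHl // /word_ins !map_cat map_max_max map_take map_drop -!catA.
  rewrite (nth_map ord0) ?size_bword //; congr (_ ++ (_ ++ _)).
  (* If [i] is the last leaf of [l], what follows it is exactly the word coming from [r]. *)
  have [//|ll] := ltnP i.+1 (leaves l).
  have -> : i.+1 = leaves l by lia.
  by rewrite subnn drop0 drop_oversize // size_map size_bword.
have ir : (i - leaves l < leaves r)%N by lia.
rewrite ifF ?IHr //; last by lia.
rewrite /word_ins !map_cat map_max_max map_take map_drop -!catA.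
by rewrite (nth_map ord0) ?size_bword // subSn.
Qed.

Fact size_tree_word n (t : tree G n) : size (bword (val t)) == n.+1.
Proof. by rewrite size_bword (valP t). Qed.

Definition tree_word n (t : tree G n) : word gamma n :=
  Tuple (size_tree_word t).

Lemma tree_word_comp n m (s : tree G n) (i : 'I_n.+1) (t : tree G m) :
  tree_word (tree_comp s i t) = word_comp (tree_word s) i (tree_word t).
Proof.
apply: word_inj; rewrite /= bword_graft ?(eqP (valP s)) //.
by rewrite (tnth_nth ord0).
Qed.

Lemma letter_max (a b : 'I_gamma) :
  letter (Order.max a b) = Order.max (letter a) (letter b).
Proof.
rewrite /Order.max !ltEord /=; case: ifP => ab; case: ifP => //;
  rewrite /bump /=; lia.
Qed.

Lemma max_letter_lt (a b : 'I_gamma) : (a < b)%N ->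
  Order.max (letter a) (letter b) = letter b.
Proof. by move=> ab; rewrite -letter_max /Order.max ltEord ab. Qed.

Lemma max_letter_ge (a b : 'I_gamma) : (b <= a)%N ->
  Order.max (letter a) (letter b) = letter a.
Proof. by move=> ba; rewrite -letter_max /Order.max ltEord ltnNge ba. Qed.

(** Equality of words is an equivalence relation, so only the listed pairs need checking; there,
    comparing the two labels resolves every maximum. *)
Lemma bword_rel n (s t : tree G n) :
  dias_rel s t -> bword (val s) = bword (val t).
Proof.
elim=> {s t} [s t|//|//|s t r _ -> _ ->] //.
by case=> [a b|a b ab|a b ab|a b ab|a b ab|a b ab|a b ab|a b ab|a b ab] /=;
  rewrite ?max0x ?maxx0 ?maxxx ?(max_letter_lt ab) ?(max_letter_ge ab).
Qed.

End Words.

(** * Normal forms: trees with the same word are equivalent *)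

Section Completeness.
Variables (K : fieldType) (gamma : nat).
Local Notation M := 'I_gamma.+1.
Local Notation G := (dias_gen gamma).
Local Notation L a := (Node (inl a : G)).
Local Notation R a := (Node (inr a : G)).
Local Notation Lf := (@Leaf (Choice.sort G)).

Variable I : operad_ideal (free_operad K G).
Hypothesis dias_relI : forall s t : tree G 2,
  dias_rel0 s t -> free_basis K s - free_basis K t \in I 2%N.
Local Notation "s ≈ t" := (tree_equiv I s t) (at level 70).

(** This rule sinks a [dashv] node below a [vdash] node. In the eight rules that follow, the right
    child of a [dashv] node, or the left child of a [vdash] node, loses its root and is replaced by
    its two subtrees; this is what makes the structural inductions on arms work. *)
Lemma equiv_LR (a b : 'I_gamma) x y z : L a (R b x y) z ≈ R b x (L a y z).
Proof. exact: (tree_equiv_subst3 x y z (dias_relI (dias_rel_LR a b))). Qed.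

Lemma equiv_Ll (a b : 'I_gamma) x y z : (a < b)%N ->
  L a x (L b y z) ≈ L b (L a x y) z.
Proof.
move=> ab; apply: tree_equiv_sym.
exact: (tree_equiv_subst3 x y z (dias_relI (dias_rel_LLL ab))).
Qed.

Lemma equiv_Lr (a b : 'I_gamma) x y z : (a < b)%N ->
  L a x (R b y z) ≈ L a (L b x y) z.
Proof.
move=> ab; apply: tree_equiv_sym.
exact: (tree_equiv_subst3 x y z (dias_relI (dias_rel_LLR ab))).
Qed.

Lemma equiv_Rl (a b : 'I_gamma) x y z : (a < b)%N ->
  R a (L b x y) z ≈ R a x (R b y z).
Proof.
move=> ab.
exact: (tree_equiv_subst3 x y z (dias_relI (dias_rel_RLR ab))).
Qed.

Lemma equiv_Rr (a b : 'I_gamma) x y z : (a < b)%N ->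
  R a (R b x y) z ≈ R b x (R a y z).
Proof.
move=> ab.
exact: (tree_equiv_subst3 x y z (dias_relI (dias_rel_RRR ab))).
Qed.

Lemma equiv_Lle (a b : 'I_gamma) x y z : (b <= a)%N ->
  L a x (L b y z) ≈ L a (L a x y) z.
Proof.
move=> ba; apply: tree_equiv_sym.
exact: (tree_equiv_subst3 x y z (dias_relI (dias_rel_Ldd_Ldc ba))).
Qed.

Lemma equiv_Lre (a b : 'I_gamma) x y z : (b <= a)%N ->
  L a x (R b y z) ≈ L a (L a x y) z.
Proof.
move=> ba; apply: tree_equiv_sym.
apply: tree_equiv_trans (tree_equiv_sym (equiv_Lle x y z ba)) _.
exact: (tree_equiv_subst3 x y z (dias_relI (dias_rel_Ldc_LRc ba))).
Qed.

Lemma equiv_Rre (a b : 'I_gamma) x y z : (b <= a)%N ->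
  R a (R b x y) z ≈ R a x (R a y z).
Proof.
move=> ba.
exact: (tree_equiv_subst3 x y z (dias_relI (dias_rel_RRc_Rdd ba))).
Qed.

Lemma equiv_Rle (a b : 'I_gamma) x y z : (b <= a)%N ->
  R a (L b x y) z ≈ R a x (R a y z).
Proof.
move=> ba; apply: tree_equiv_trans (equiv_Rre x y z ba).
exact: (tree_equiv_subst3 x y z (dias_relI (dias_rel_RLc_RRc ba))).
Qed.

(** The head of [v] labels the deepest added node, so that [v] lists the letters of the added leaves
    from left to right. *)
Definition lcomb (x : bintree G) (v : seq 'I_gamma) : bintree G :=
  foldl (fun t c => L c t Lf) x v.

Definition rcomb (u : seq 'I_gamma) (x : bintree G) : bintree G :=
  foldr (fun c t => R c Lf t) x u.

Lemma equiv_lcomb x y v : x ≈ y -> lcomb x v ≈ lcomb y v.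
Proof.
elim: v x y => //= c v IHv x y xy; apply: IHv.
by apply: tree_equiv_node => //; apply: tree_equiv_refl.
Qed.

Lemma equiv_rcomb x y u : x ≈ y -> rcomb u x ≈ rcomb u y.
Proof.
move=> xy; elim: u => //= c u IHu.
by apply: tree_equiv_node => //; apply: tree_equiv_refl.
Qed.

(** The induction needs [a] general, because one subtree of [t] sees a new label, and [w]
    independent of [x], because the arm of the second subtree is attached on top of the arm of the
    first. *)
Lemma left_arm t a : exists w,
  [seq Order.max (letter a) x | x <- bword t] = map (@letter gamma) w /\
  forall x, L a x t ≈ lcomb x w.
Proof.
elim: t a => [|[] b y IHy z IHz] a /=.
- by exists [:: a]; rewrite /= maxx0; split=> // x; apply: tree_equiv_refl.
- have [wy [Ey Hy]] := IHy a.
  (* Here [c] is the larger of [a] and [b]. The left letter of [dashv] being 0, [y] still sees [a],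
     while [z] sees [c]. *)
  have combine c : Order.max (letter a) (letter b) = letter c :> M ->
      (forall x, L a x (L b y z) ≈ L c (L a x y) z) -> exists w,
      [seq Order.max (letter a) x | x <- bword (L b y z)] =
        map (@letter gamma) w /\
      forall x, L a x (L b y z) ≈ lcomb x w.
    move=> Ec Hc; have [wz [Ez Hz]] := IHz c; exists (wy ++ wz); split=> [|x].
      by rewrite /= !map_cat !map_max_max Ec maxx0 Ey Ez.
    rewrite /lcomb foldl_cat; apply: tree_equiv_trans (Hc x) _.
    apply: tree_equiv_trans (Hz _) _; exact: equiv_lcomb.
  have [ab|ba] := ltnP a b.
    by apply: (combine b); [apply: max_letter_lt | move=> x; apply: equiv_Ll].
  by apply: (combine a); [apply: max_letter_ge | move=> x; apply: equiv_Lle].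
- have [wz [Ez Hz]] := IHz a.
  (* With [vdash] the roles are exchanged: [y] sees [c] and [z] sees [a]. *)
  have combine c : Order.max (letter a) (letter b) = letter c :> M ->
      (forall x, L a x (R b y z) ≈ L a (L c x y) z) -> exists w,
      [seq Order.max (letter a) x | x <- bword (R b y z)] =
        map (@letter gamma) w /\
      forall x, L a x (R b y z) ≈ lcomb x w.
    move=> Ec Hc; have [wy [Ey Hy]] := IHy c; exists (wy ++ wz); split=> [|x].
      by rewrite /= !map_cat !map_max_max Ec maxx0 Ey Ez.
    rewrite /lcomb foldl_cat; apply: tree_equiv_trans (Hc x) _.
    apply: tree_equiv_trans (Hz _) _; exact: equiv_lcomb.
  have [ab|ba] := ltnP a b.
    by apply: (combine b); [apply: max_letter_lt | move=> x; apply: equiv_Lr].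
  by apply: (combine a); [apply: max_letter_ge | move=> x; apply: equiv_Lre].
Qed.

(** Mirror image of [left_arm]; the arm of [y] is now the outer one, closer to the root. *)
Lemma right_arm t a : exists w,
  [seq Order.max (letter a) x | x <- bword t] = map (@letter gamma) w /\
  forall x, R a t x ≈ rcomb w x.
Proof.
elim: t a => [|[] b y IHy z IHz] a /=.
- by exists [:: a]; rewrite /= maxx0; split=> // x; apply: tree_equiv_refl.
- have [wy [Ey Hy]] := IHy a.
  have combine c : Order.max (letter a) (letter b) = letter c :> M ->
      (forall x, R a (L b y z) x ≈ R a y (R c z x)) -> exists w,
      [seq Order.max (letter a) x | x <- bword (L b y z)] =
        map (@letter gamma) w /\
      forall x, R a (L b y z) x ≈ rcomb w x.
    move=> Ec Hc; have [wz [Ez Hz]] := IHz c; exists (wy ++ wz); split=> [|x].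
      by rewrite /= !map_cat !map_max_max Ec maxx0 Ey Ez.
    rewrite /rcomb foldr_cat; apply: tree_equiv_trans (Hc x) _.
    apply: tree_equiv_trans (Hy _) _; exact: equiv_rcomb.
  have [ab|ba] := ltnP a b.
    by apply: (combine b); [apply: max_letter_lt | move=> x; apply: equiv_Rl].
  by apply: (combine a); [apply: max_letter_ge | move=> x; apply: equiv_Rle].
- have [wz [Ez Hz]] := IHz a.
  have combine c : Order.max (letter a) (letter b) = letter c :> M ->
      (forall x, R a (R b y z) x ≈ R c y (R a z x)) -> exists w,
      [seq Order.max (letter a) x | x <- bword (R b y z)] =
        map (@letter gamma) w /\
      forall x, R a (R b y z) x ≈ rcomb w x.
    move=> Ec Hc; have [wy [Ey Hy]] := IHy c; exists (wy ++ wz); split=> [|x].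
      by rewrite /= !map_cat !map_max_max Ec maxx0 Ey Ez.
    rewrite /rcomb foldr_cat; apply: tree_equiv_trans (Hc x) _.
    apply: tree_equiv_trans (Hy _) _; exact: equiv_rcomb.
  have [ab|ba] := ltnP a b.
    by apply: (combine b); [apply: max_letter_lt | move=> x; apply: equiv_Rr].
  by apply: (combine a); [apply: max_letter_ge | move=> x; apply: equiv_Rre].
Qed.

Lemma equiv_L_rcomb a u x y : L a (rcomb u x) y ≈ rcomb u (L a x y).
Proof.
elim: u => [|c u IHu] /=; first exact: tree_equiv_refl.
apply: tree_equiv_trans (equiv_LR _ _ _ _ _) _.
by apply: tree_equiv_node => //; apply: tree_equiv_refl.
Qed.

(** At a [dashv] root, the left child is normalised by induction and the right child becomes an arm
    appended to [v], once the root has sunk below the [vdash] nodes. At a [vdash] root, the left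
    child becomes an arm put in front of [u]. *)
Lemma equiv_normal_form t : exists u v,
  bword t = map (@letter gamma) u ++ ord0 :: map (@letter gamma) v /\
  t ≈ rcomb u (lcomb Lf v).
Proof.
elim: t => [|[] a l [ul [vl [El Hl]]] r [ur [vr [Er Hr]]]].
- by exists [::], [::]; split=> //; apply: tree_equiv_refl.
- have [w [Ew Hw]] := left_arm r a.
  exists ul, (vl ++ w); split; first by rewrite /= map_max0 El Ew map_cat -catA.
  apply: (@tree_equiv_trans _ _ _ _ (L a (rcomb ul (lcomb Lf vl)) r)).
    by apply: tree_equiv_node => //; apply: tree_equiv_refl.
  apply: tree_equiv_trans (equiv_L_rcomb _ _ _ _) _.
  by rewrite /lcomb foldl_cat; apply/equiv_rcomb/Hw.
- have [w [Ew Hw]] := right_arm l a.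
  exists (w ++ ur), vr; split; first by rewrite /= map_max0 Er Ew map_cat -catA.
  rewrite /rcomb foldr_cat; apply: tree_equiv_trans (Hw _) _.
  exact: equiv_rcomb.
Qed.

Lemma letter_inj : injective (@letter gamma).
Proof. exact: lift_inj. Qed.

(** No [letter] is 0, so the only 0 of the word marks the splitting point. Hence the word determines
    the normal form. *)
Lemma split_at_ord0 (u u' v v' : seq 'I_gamma) :
  map (@letter gamma) u ++ ord0 :: map (@letter gamma) v =
  map (@letter gamma) u' ++ ord0 :: map (@letter gamma) v' ->
  u = u' /\ v = v'.
Proof.
elim: u u' => [|a u IHu] [|a' u'] //=; first by case=> /(inj_map (@letter_inj)).
by move/eqP; rewrite eqseq_cons => /andP[/eqP/letter_inj -> /eqP/IHu[-> ->]].
Qed.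

Lemma bword_equiv s t : bword s = bword t -> s ≈ t.
Proof.
have [u [v [-> sE]]] := equiv_normal_form s.
have [u' [v' [-> tE]]] := equiv_normal_form t.
move=> /split_at_ord0[eu ev]; subst u' v'.
exact: tree_equiv_trans sE (tree_equiv_sym tE).
Qed.

End Completeness.

(** * The operad morphism from the free operad to [TM] *)

Section TreesToWords.
Variables (K : fieldType) (gamma : nat).
Local Notation G := (dias_gen gamma).
Local Notation free := (free_operad K G).

Definition word_map n (x : free n) : TM K gamma n :=
  malg_lift (fun t : tree G n => word_basis K (tree_word t)) x.

Fact word_map_linear n : linear (@word_map n).
Proof. exact: malg_lift_linear. Qed.
HB.instance Definition _ n :=
  GRing.isLinear.Build K (free n) (TM K gamma n) _ (@word_map n)
    (@word_map_linear n).

Lemma word_map_basis n (t : tree G n) :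
  word_map (free_basis K t) = word_basis K (tree_word t).
Proof. exact: malg_liftU. Qed.

Lemma word_map_one : word_map (op_one free) = op_one (TM K gamma).
Proof.
apply: etrans (word_map_basis (tree_one G)) _.
by congr (word_basis K _); apply: word_inj.
Qed.

Lemma word_map_comp n m (x : free n) (i : 'I_n.+1) (y : free m) :
  word_map (op_comp x i y) = op_comp (word_map x) i (word_map y).
Proof.
apply: (malg_ind (f := fun x : free n => word_map (op_comp x i y))
  (g := fun x : free n => op_comp (word_map x) i (word_map y))) => [||s].
- exact: linear_comp (@word_map_linear _) (@op_linl K free _ _ i y).
- exact: linear_comp (@op_linl K (TM K gamma) _ _ i _) (@word_map_linear _).
apply: (malg_ind (f := fun y : free m =>
    word_map (op_comp (free_basis K s) i y))
  (g := fun y : free m => op_comp (word_map (free_basis K s)) i (word_map y)))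
  => [||t].
- exact: linear_comp (@word_map_linear _) (@op_linr K free _ _ _ i).
- exact: linear_comp (@op_linr K (TM K gamma) _ _ _ i) (@word_map_linear _).
have -> : op_comp (free_basis K s) i (<< t >> : free m) =
  free_basis K (tree_comp s i t) by apply: free_basis_comp.
have -> : word_map (<< t >> : free m) = word_basis K (tree_word t).
  exact: word_map_basis.
rewrite !word_map_basis tree_word_comp; exact/esym/word_basis_comp.
Qed.

(** Every tree is built from the unit and corollas by composition, and corollas are sent to the
    generating words. *)
Lemma dias_tree_word n (t : tree G n) :
  word_basis K (tree_word t) \in gen_suboperad (@dias_word K gamma) n.
Proof.
apply/asboolP => S XS; case: t => t.
elim: t n => [|g l IHl r IHr] n et.
  have en : 0%N = n by apply: succn_inj; rewrite -(eqP et).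
  case: n / en et => et.
  have -> : tree_word (exist _ Leaf et : tree G 0) = word_one gamma.
    exact: word_inj.
  exact: sub_one.
have el : leaves l == (leaves l).-1.+1 by rewrite prednK // leaves_gt0.
have er : leaves r == (leaves r).-1.+1 by rewrite prednK // leaves_gt0.
(* The order of the summands reflects grafting [r] on the last leaf before [l] on the first; arities
   are leaf counts minus one. *)
have en : (1 + (leaves r).-1 + (leaves l).-1 = n)%N.
  by move: et el er => /= /eqP et /eqP el /eqP er; lia.
case: n / en et => et.
have -> : (exist _ (Node g l r) et : tree G _) =
    tree_comp (tree_comp (corolla g) ord_max (exist _ r er : tree G _)) ord0
      (exist _ l el : tree G _) by apply: val_inj.
rewrite !tree_word_comp -!word_basis_comp; apply: sub_comp; last exact: IHl.
apply: sub_comp; last exact: IHr.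
apply: XS; case: g {et} => a.
  have -> : tree_word (corolla (inl a : G)) = [tuple ord0; letter a].
    by apply: word_inj; rewrite /= max0x maxx0.
  exact: dias_word_0a.
have -> : tree_word (corolla (inr a : G)) = [tuple letter a; ord0].
  by apply: word_inj; rewrite /= max0x maxx0.
exact: dias_word_a0.
Qed.

End TreesToWords.

(** * Image and kernel of the morphism onto [Dias] *)

Section DiasPresentation.
Variables (K : fieldType) (gamma : nat).
Local Notation G := (dias_gen gamma).
Local Notation free := (free_operad K G).
Local Notation I := (gen_ideal (relation_space K (@dias_rel gamma))).

Fact word_map_in_dias n (x : free n) :
  word_map x \in gen_suboperad (@dias_word K gamma) n.
Proof. by apply: rpred_sum => t _; apply/rpredZ/dias_tree_word. Qed.

Definition dias_map n (x : free n) : Dias K gamma n :=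
  exist _ (word_map x) (word_map_in_dias x).

Fact dias_map_linear n : linear (@dias_map n).
Proof.
by move=> a x y; apply/val_inj; rewrite [RHS]linearP; apply: word_map_linear.
Qed.
HB.instance Definition _ n :=
  GRing.isLinear.Build K (free n) (Dias K gamma n) _ (@dias_map n)
    (@dias_map_linear n).

(** The image is a suboperad containing the generating words, hence contains the generated
    suboperad; this gives surjectivity onto [Dias]. *)
Definition word_image n : {pred TM K gamma n} :=
  fun u => `[< exists x : free n, word_map x = u >].

Fact word_image_closed n : submod_closed (@word_image n).
Proof.
split=> [|a u v /asboolP[x <-] /asboolP[y <-]]; apply/asboolP.
  by exists 0; rewrite linear0.
by exists (a *: x + y); rewrite linearP.
Qed.
HB.instance Definition _ n :=
  GRing.isSubmodClosed.Build K (TM K gamma n) (@word_image n)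
    (@word_image_closed n).

Fact word_image_one : op_one (TM K gamma) \in @word_image 0.
Proof.
by apply/asboolP; exists (op_one free); apply: word_map_one.
Qed.

Fact word_image_comp n m (u : TM K gamma n) (i : 'I_n.+1) (v : TM K gamma m) :
  u \in @word_image n -> v \in @word_image m ->
  op_comp u i v \in @word_image (n + m).
Proof.
move=> /asboolP[x <-] /asboolP[y <-]; apply/asboolP.
by exists (op_comp x i y); apply: word_map_comp.
Qed.

Definition word_image_suboperad : suboperad (TM K gamma) :=
  @Suboperad K (TM K gamma) (fun n => @word_image n) word_image_one
    word_image_comp.

Lemma dias_map_surj n (u : Dias K gamma n) : exists x, dias_map x == u.
Proof.
case: u => u uD; have /asboolP[x xE] : u \in @word_image n.
  move: uD => /asboolP/(_ word_image_suboperad); apply=> m v.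
  case=> a; apply/asboolP.
    exists (free_basis K (corolla (inl a : G))); rewrite word_map_basis.
    by congr (word_basis K _); apply: word_inj; rewrite /= max0x maxx0.
  exists (free_basis K (corolla (inr a : G))); rewrite word_map_basis.
  by congr (word_basis K _); apply: word_inj; rewrite /= max0x maxx0.
by exists x; apply/eqP/val_inj.
Qed.

(** The kernel is an ideal containing the relations, hence contains the ideal they generate. *)
Definition word_ker n : {pred free n} := fun x => word_map x == 0.

Fact word_ker_closed n : submod_closed (@word_ker n).
Proof.
split=> [|a x y /eqP x0 /eqP y0]; apply/eqP; first exact: linear0.
by rewrite linearP /= x0 y0 scaler0 addr0.
Qed.
HB.instance Definition _ n :=
  GRing.isSubmodClosed.Build K (free n) (@word_ker n) (@word_ker_closed n).

Fact word_ker_compl n m (x : free n) (i : 'I_n.+1) (y : free m) :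
  x \in @word_ker n -> op_comp x i y \in @word_ker (n + m).
Proof.
(* Writing 0 as [0 - 0] lets bilinearity show that composing with 0 gives 0. *)
move=> /eqP x0; apply/eqP; rewrite word_map_comp x0 -[0 in LHS](subrr 0).
by apply: etrans (esym (op_compBl _ _ _ _)) _; apply: subrr.
Qed.

Fact word_ker_compr n m (x : free n) (i : 'I_n.+1) (y : free m) :
  y \in @word_ker m -> op_comp x i y \in @word_ker (n + m).
Proof.
move=> /eqP y0; apply/eqP; rewrite word_map_comp y0 -[0 in LHS](subrr 0).
by apply: etrans (esym (op_compBr _ _ _ _)) _; apply: subrr.
Qed.

Definition word_ker_ideal : operad_ideal free :=
  @OperadIdeal K free (fun n => @word_ker n) word_ker_compl word_ker_compr.

Lemma dias_rel_in_ideal (s t : tree G 2) :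
  dias_rel0 s t -> free_basis K s - free_basis K t \in I 2%N.
Proof.
move=> st; apply/asboolP => J; apply; apply/asboolP => W; apply.
by exists s, t; split=> //; apply: rst_step.
Qed.

Lemma word_map_rel n (s t : tree G n) : dias_rel s t ->
  word_map (free_basis K s - free_basis K t) = 0.
Proof.
move=> st; apply: etrans (linearB (@word_map K gamma n) _ _) _.
apply/eqP; rewrite subr_eq0; apply/eqP.
rewrite [LHS]word_map_basis [RHS]word_map_basis.
by congr word_basis; apply/word_inj/bword_rel.
Qed.

(** From left to right, [malg_map_ker] reduces the claim to pairs of trees with equal words, which
    the normal forms settle. The converse is minimality of the generated ideal and of the span of
    relations. *)
Lemma dias_map_ker n (x : free n) : dias_map x = 0 <-> x \in I n.
Proof.
split=> [/(congr1 val) x0|/asboolP/(_ word_ker_ideal) xI].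
  apply: malg_map_ker x0 => s t st.
  apply/(tree_equivP I); apply: (bword_equiv dias_rel_in_ideal).
  exact: (congr1 val st).
apply/val_inj/eqP; apply: xI => m y /asboolP; apply=> {}y [s [t [st ->]]].
exact/eqP/word_map_rel.
Qed.

End DiasPresentation.

Theorem theorem2p2p6 (K : fieldType) (charK : [pchar K]%R =i pred0)
    (gamma : nat) :
  admits_presentation (Dias K gamma)
    (relation_space K (@dias_rel gamma)).
Proof.
apply: (first_isomorphism (phi := @dias_map K gamma)).
- apply/val_inj; exact: word_map_one.
- by move=> n m x i y; apply/val_inj; apply: word_map_comp.
- exact: dias_map_surj.
- exact: dias_map_ker.
Qed.
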